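(* Let $0<q<1$, and let $\mathcal{O}(D_q)$, $x$, $\Omega^1(D_q)$ and the divergence $\nabla_0$ be as defined in the context. The integral associated to $\nabla_0$, i.e. the cokernel map of $\nabla_0$, is a map $\Lambda:\mathcal{O}(D_q)\to\mathbb{C}$ (that is, the cokernel of the linear map $\nabla_0$ is identified with the one-dimensional vector space $\mathbb{C}$), given by $$\Lambda(x^kz^l)=\lambda\,\frac{[k+1;q^2]}{[k+1;q^4]}\,\delta_{l,0},\qquad\text{for all } k\in\mathbb{N},\ l\in\mathbb{Z},$$ where, for $l<0$, $z^l$ means ${z^*}^{-l}$, and $\lambda\in\mathbb{C}$ is a constant (depending only on the choice of the identification of the cokernel with $\mathbb{C}$).
   Context: $\mathcal{O}(D_q)$ (the quantum disc algebra) is the complex unital $*$-algebra generated by $z$ subject to $z^*z-q^2zz^*=1-q^2$, and $x=1-zz^*$. The monomials $x^kz^l$, $x^k{z^*}^l$ with $k,l\ge 0$ form a linear basis of $\mathcal{O}(D_q)$ (those with $l=0$ counted once). Here $\mathbb{N}$ includes $0$, and $[n;s]:=\frac{s^n-1}{s-1}$. $\mathcal{O}(D_q)$ is $\mathbb{Z}$-graded by $\deg(z)=1$, $\deg(z^* )=-1$. The automorphism $\sigma$ is given on homogeneous elements by $\sigma(a)=q^{2\deg(a)}a$. The linear maps $\partial,\bar\partial:\mathcal{O}(D_q)\to\mathcal{O}(D_q)$ are the skew-derivations determined by $$\partial(z)=z^*,\quad \partial(z^* )=0,\qquad \bar\partial(z)=0,\quad \bar\partial(z^* )=q^2z,$$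 and the right $\sigma$-twisted Leibniz rule $\partial(ab)=\partial(a)\sigma(b)+a\partial(b)$, $\bar\partial(ab)=\bar\partial(a)\sigma(b)+a\bar\partial(b)$ (it is known that these are well defined). $\Omega^1(D_q)$ is the $\mathcal{O}(D_q)$-bimodule that is free as a left module on $\omega,\omega^*$ (where $\omega^*$ is also written $\bar\omega$), with right action determined by $\omega a=\sigma(a)\omega$, $\omega^*a=\sigma(a)\omega^*$, and with differential $d(a)=\partial(a)\omega+\bar\partial(a)\omega^*$. The divergence $\nabla_0$ is the linear map from the space of right $\mathcal{O}(D_q)$-linear maps $f:\Omega^1(D_q)\to\mathcal{O}(D_q)$ to $\mathcal{O}(D_q)$ given by $$\nabla_0(f)=q^4\,\partial\left(f(\omega)\right)+q^{-4}\,\bar\partial\left(f(\omega^* )\right).$$ The integral associated to $\nabla_0$ is the cokernel map of $\nabla_0$, i.e. the canonical projection $\mathcal{O}(D_q)\to\mathcal{O}(D_q)/\mathrm{Im}(\nabla_0)$. *)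

(* Defs.v *)
From HB Require Import structures.
From mathcomp Require Import all_boot all_order all_algebra.
From mathcomp Require Import ring_quotient generic_quotient.
From mathcomp Require Import all_classical all_reals.
From mathcomp Require Import complex.
Set Implicit Arguments. Unset Strict Implicit. Unset Printing Implicit Defensive.
Import Order.TTheory GRing.Theory Num.Theory.
Local Open Scope ring_scope.
Local Open Scope complex_scope.
Local Open Scope quotient_scope.

(* [n; s] *)
Definition qnum (F : fieldType) (n : nat) (s : F) : F := (s ^+ n - 1) / (s - 1).

Section Cokernel.
Variables (K : nzRingType) (U V : lmodType K) (f : {linear U -> V}).

Definition im_lin : {pred V} := fun v => `[< exists u, f u = v >].

Lemma im_linP v : reflect (exists u, f u = v) (v \in im_lin).
Proof. exact: asboolP. Qed.

Fact im_lin_submod_closed : submod_closed im_lin.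
Proof.
split; first by apply/im_linP; exists 0; rewrite linear0.
move=> a _ _ /im_linP[u <-] /im_linP[w <-].
by apply/im_linP; exists (a *: u + w); rewrite linearP.
Qed.
HB.instance Definition _ :=
  GRing.isSubmodClosed.Build K V im_lin im_lin_submod_closed.

Definition coker := Quotient.quot im_lin.
HB.instance Definition _ := GRing.Zmodule.on coker.

Definition to_coker (v : V) : coker := \pi_(Quotient.quot im_lin) v.

Lemma to_cokerB : {morph to_coker : x y / x - y}.
Proof. by move=> x y; rewrite /to_coker !piE. Qed.
HB.instance Definition _ := GRing.isZmodMorphism.Build V coker to_coker to_cokerB.

Lemma to_coker_eq x y : to_coker x = to_coker y <-> exists u, f u = x - y.
Proof.
split=> [/eqP|[u fu]]; rewrite /to_coker.
  by rewrite -Quotient.idealrBE => /im_linP.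
by apply/eqP; rewrite -Quotient.idealrBE; apply/im_linP; exists u.
Qed.

Lemma to_coker_surj (c : coker) : exists v, to_coker v = c.
Proof. by exists (repr (c : Quotient.quot im_lin)); exact: reprK. Qed.

Definition coker_scale (a : K) (c : coker) : coker :=
  to_coker (a *: repr (c : Quotient.quot im_lin)).

Lemma to_cokerZ a v : to_coker (a *: v) = coker_scale a (to_coker v).
Proof.
apply/to_coker_eq.
have [u fu] : exists u, f u = v - repr (to_coker v : Quotient.quot im_lin).
  by apply/to_coker_eq; rewrite [RHS]reprK.
by exists (a *: u); rewrite linearZ_LR fu scalerBr.
Qed.

Fact coker_scaleA a b c : coker_scale a (coker_scale b c) = coker_scale (a * b) c.
Proof.
by have [v <-] := to_coker_surj c; rewrite -!to_cokerZ scalerA.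
Qed.
Fact coker_scale1 : left_id 1 coker_scale.
Proof. by move=> c; have [v <-] := to_coker_surj c; rewrite -to_cokerZ scale1r. Qed.
Fact coker_scaleDr : right_distributive coker_scale +%R.
Proof.
move=> a c c'; have [v <-] := to_coker_surj c; have [w <-] := to_coker_surj c'.
by rewrite -raddfD -!to_cokerZ scalerDr raddfD.
Qed.
Fact coker_scaleDl c : {morph coker_scale^~ c : a b / a + b}.
Proof.
move=> a b; have [v <-] := to_coker_surj c.
by rewrite -!to_cokerZ scalerDl raddfD.
Qed.
HB.instance Definition _ := GRing.Zmodule_isLmodule.Build K coker
  coker_scaleA coker_scale1 coker_scaleDr coker_scaleDl.
HB.instance Definition _ := GRing.isScalable.Build K V coker *:%R to_coker to_cokerZ.

End Cokernel.

(* O(D_q) as the unital algebra presented by the generators z, z* and the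
   defining relation: formal noncommutative expressions modulo the least
   congruence that contains the algebra axioms and the relation. As the relation
   is self-adjoint, this is the *-algebra presented by z and the relation; the
   involution is [star] below. *)
Inductive qdisc_expr (C : Type) : Type :=
  | QZ | QZs | QC of C
  | QAdd of qdisc_expr C & qdisc_expr C
  | QMul of qdisc_expr C & qdisc_expr C.
Arguments QZ {C}.
Arguments QZs {C}.

Inductive qdisc_rel (C : nzRingType) (q : C) :
    qdisc_expr C -> qdisc_expr C -> Prop :=
  | qd_refl a : qdisc_rel q a a
  | qd_sym a b : qdisc_rel q a b -> qdisc_rel q b a
  | qd_trans b a c : qdisc_rel q a b -> qdisc_rel q b c -> qdisc_rel q a c
  | qd_congA a a' b b' : qdisc_rel q a a' -> qdisc_rel q b b' ->
      qdisc_rel q (QAdd a b) (QAdd a' b')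
  | qd_congM a a' b b' : qdisc_rel q a a' -> qdisc_rel q b b' ->
      qdisc_rel q (QMul a b) (QMul a' b')
  | qd_addA a b c : qdisc_rel q (QAdd a (QAdd b c)) (QAdd (QAdd a b) c)
  | qd_addC a b : qdisc_rel q (QAdd a b) (QAdd b a)
  | qd_add0 a : qdisc_rel q (QAdd (QC 0) a) a
  | qd_addN a : qdisc_rel q (QAdd (QMul (QC (-1)) a) a) (QC 0)
  | qd_mulA a b c : qdisc_rel q (QMul a (QMul b c)) (QMul (QMul a b) c)
  | qd_mul1l a : qdisc_rel q (QMul (QC 1) a) a
  | qd_mul1r a : qdisc_rel q (QMul a (QC 1)) a
  | qd_mulDl a b c : qdisc_rel q (QMul (QAdd a b) c) (QAdd (QMul a c) (QMul b c))
  | qd_mulDr a b c : qdisc_rel q (QMul a (QAdd b c)) (QAdd (QMul a b) (QMul a c))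
  | qd_constD c d : qdisc_rel q (QC (c + d)) (QAdd (QC c) (QC d))
  | qd_constM c d : qdisc_rel q (QC (c * d)) (QMul (QC c) (QC d))
  | qd_central c a : qdisc_rel q (QMul (QC c) a) (QMul a (QC c))
  (* z* z = q^2 z z* + (1 - q^2) *)
  | qd_disc : qdisc_rel q (QMul QZs QZ)
      (QAdd (QMul (QC (q ^+ 2)) (QMul QZ QZs)) (QC (1 - q ^+ 2))).

HB.instance Definition _ (C : Type) := gen_eqMixin (qdisc_expr C).
HB.instance Definition _ (C : Type) := gen_choiceMixin (qdisc_expr C).

Section Eval.
Variables (C : nzRingType) (B : algType C) (u v : B).
Fixpoint qeval (t : qdisc_expr C) : B :=
  match t with
  | QZ => u | QZs => v | QC c => c%:A
  | QAdd a b => qeval a + qeval b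
  | QMul a b => qeval a * qeval b
  end.

Lemma qeval_rel (q : C) : v * u = q ^+ 2 *: (u * v) + (1 - q ^+ 2)%:A ->
  forall s t, qdisc_rel q s t -> qeval s = qeval t.
Proof.
move=> uv s t; elim=> //=.
- by move=> b a c _ -> _ ->.
- by move=> a a' b b' _ -> _ ->.
- by move=> a a' b b' _ -> _ ->.
- by move=> a b c; rewrite addrA.
- by move=> a b; rewrite addrC.
- by move=> a; rewrite scale0r add0r.
- by move=> a; rewrite mulr_algl scaleN1r addNr scale0r.
- by move=> a b c; rewrite mulrA.
- by move=> a; rewrite scale1r mul1r.
- by move=> a; rewrite scale1r mulr1.
- by move=> a b c; rewrite mulrDl.
- by move=> a b c; rewrite mulrDr.
- by move=> c d; rewrite scalerDl.
- by move=> c d; rewrite mulr_algl scalerA.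
- by move=> c a; rewrite mulr_algl mulr_algr.
- by rewrite uv mulr_algl.
Qed.
End Eval.

Section QDisc.
Variables (R : realType) (q : R) (q01 : 0 < q < 1).
Local Notation C := R[i].
Local Notation qC := (q%:C : C).

Lemma qC_neq0 : qC != 0.
Proof.
by case/andP: q01 => q0 _; rewrite -(rmorph0 (real_complex R)) fmorph_eq0 gt_eqF.
Qed.

Definition qdisc_eqv : rel (qdisc_expr C) := fun a b => `[< qdisc_rel qC a b >].

Lemma qdisc_eqv_equiv : equiv_class_of qdisc_eqv.
Proof.
split=> [a|a b|b a c]; first by apply/asboolP; exact: qd_refl.
  by apply/asboolP/asboolP; exact: qd_sym.
by move=> /asboolP ab /asboolP bc; apply/asboolP; exact: qd_trans bc.
Qed.
Canonical qdisc_equiv := EquivRelPack qdisc_eqv_equiv.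
Canonical qdisc_enc := defaultEncModRel qdisc_eqv.

Definition qdisc_quot := {eq_quot qdisc_eqv}.
HB.instance Definition _ := Choice.on qdisc_quot.
HB.instance Definition _ := EqQuotient.on qdisc_quot.

(* The proof that 0 < q < 1 is a (phantom) parameter of the type, so that it is
   available to the structures on it. *)
Definition qdisc of 0 < q < 1 := qdisc_quot.
Local Notation A := (qdisc q01).
HB.instance Definition _ := Choice.on A.

Definition qcls (t : qdisc_expr C) : A := \pi_qdisc_quot t.
Definition qrep (a : A) : qdisc_expr C := repr (a : qdisc_quot).

Lemma qrepK a : qcls (qrep a) = a. Proof. exact: reprK. Qed.

Lemma qcls_eq s t : qcls s = qcls t <-> qdisc_rel qC s t.
Proof.
by split=> [/eqmodP/asboolP|st] //; apply/eqmodP/asboolP.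
Qed.

Lemma qclsP (P : A -> Prop) : (forall t, P (qcls t)) -> forall a, P a.
Proof. by move=> h a; rewrite -(qrepK a). Qed.

Definition qadd (a b : A) : A := qcls (QAdd (qrep a) (qrep b)).
Definition qmul (a b : A) : A := qcls (QMul (qrep a) (qrep b)).
Definition qopp (a : A) : A := qcls (QMul (QC (-1)) (qrep a)).
Definition qscale (c : C) (a : A) : A := qcls (QMul (QC c) (qrep a)).

Lemma qrep_cls t : qdisc_rel qC (qrep (qcls t)) t.
Proof. by apply/qcls_eq; rewrite qrepK. Qed.

Lemma qadd_cls s t : qadd (qcls s) (qcls t) = qcls (QAdd s t).
Proof. by apply/qcls_eq; apply: qd_congA; exact: qrep_cls. Qed.
Lemma qmul_cls s t : qmul (qcls s) (qcls t) = qcls (QMul s t).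
Proof. by apply/qcls_eq; apply: qd_congM; exact: qrep_cls. Qed.
Lemma qopp_cls t : qopp (qcls t) = qcls (QMul (QC (-1)) t).
Proof. by apply/qcls_eq; apply: qd_congM; [exact: qd_refl|exact: qrep_cls]. Qed.
Lemma qscale_cls c t : qscale c (qcls t) = qcls (QMul (QC c) t).
Proof. by apply/qcls_eq; apply: qd_congM; [exact: qd_refl|exact: qrep_cls]. Qed.

Let qE := (qadd_cls, qmul_cls, qopp_cls, qscale_cls).

Fact qaddA : associative qadd.
Proof.
by do 3!elim/qclsP=> ?; rewrite !qE; apply/qcls_eq; exact: qd_addA.
Qed.
Fact qaddC : commutative qadd.
Proof. by do 2!elim/qclsP=> ?; rewrite !qE; apply/qcls_eq; exact: qd_addC. Qed.
Fact qadd0 : left_id (qcls (QC 0)) qadd.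
Proof. by elim/qclsP=> ?; rewrite !qE; apply/qcls_eq; exact: qd_add0. Qed.
Fact qaddN : left_inverse (qcls (QC 0)) qopp qadd.
Proof. by elim/qclsP=> ?; rewrite !qE; apply/qcls_eq; exact: qd_addN. Qed.
HB.instance Definition _ := GRing.isZmodule.Build A qaddA qaddC qadd0 qaddN.

Fact qmulA : associative qmul.
Proof. by do 3!elim/qclsP=> ?; rewrite !qE; apply/qcls_eq; exact: qd_mulA. Qed.
Fact qmul1 : left_id (qcls (QC 1)) qmul.
Proof. by elim/qclsP=> ?; rewrite !qE; apply/qcls_eq; exact: qd_mul1l. Qed.
Fact qmulr1 : right_id (qcls (QC 1)) qmul.
Proof. by elim/qclsP=> ?; rewrite !qE; apply/qcls_eq; exact: qd_mul1r. Qed.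
Fact qmulDl : left_distributive qmul qadd.
Proof. by do 3!elim/qclsP=> ?; rewrite !qE; apply/qcls_eq; exact: qd_mulDl. Qed.
Fact qmulDr : right_distributive qmul qadd.
Proof. by do 3!elim/qclsP=> ?; rewrite !qE; apply/qcls_eq; exact: qd_mulDr. Qed.

(* z = z* = 1 satisfies the defining relation in the complex numbers. *)
Fact qone_neq0 : qcls (QC 1) != qcls (QC 0).
Proof.
apply/eqP => /qcls_eq/(qeval_rel (B := C^o) (u := 1) (v := 1)) /=.
rewrite !mulr1 scale1r scale0r => h.
have /eqP : (1 : C^o) = 0 by apply: h; rewrite -scalerDl addrCA subrr addr0 scale1r.
by rewrite oner_eq0.
Qed.
HB.instance Definition _ := GRing.Zmodule_isNzRing.Build A
  qmulA qmul1 qmulr1 qmulDl qmulDr qone_neq0.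

Fact qscaleA a b c : qscale a (qscale b c) = qscale (a * b) c.
Proof.
elim/qclsP: c => t; rewrite !qE; apply/qcls_eq.
apply: (qd_trans (qd_mulA _ _ _ _)); apply: qd_congM; last exact: qd_refl.
by apply: qd_sym; exact: qd_constM.
Qed.
Fact qscale1 : left_id 1 qscale.
Proof. by elim/qclsP=> ?; rewrite !qE; apply/qcls_eq; exact: qd_mul1l. Qed.
Fact qscaleDr : right_distributive qscale +%R.
Proof.
move=> c; do 2!elim/qclsP=> ?; rewrite /GRing.add /= !qE.
by apply/qcls_eq; exact: qd_mulDr.
Qed.
Fact qscaleDl a : {morph qscale^~ a : c d / c + d}.
Proof.
elim/qclsP: a => t c d; rewrite [in RHS]/GRing.add /= !qE; apply/qcls_eq.
apply: (qd_trans (b := QMul (QAdd (QC c) (QC d)) t)); last exact: qd_mulDl.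
by apply: qd_congM; [exact: qd_constD|exact: qd_refl].
Qed.
HB.instance Definition _ := GRing.Zmodule_isLmodule.Build C A
  qscaleA qscale1 qscaleDr qscaleDl.

Fact qscaleAl (c : C) (a b : A) : c *: (a * b) = (c *: a) * b.
Proof.
elim/qclsP: a => s; elim/qclsP: b => t.
rewrite /GRing.scale /GRing.mul /= !qE; apply/qcls_eq; exact: qd_mulA.
Qed.
HB.instance Definition _ := GRing.Lmodule_isLalgebra.Build C A qscaleAl.
Fact qscaleAr (c : C) (a b : A) : c *: (a * b) = a * (c *: b).
Proof.
elim/qclsP: a => s; elim/qclsP: b => t.
rewrite /GRing.scale /GRing.mul /= !qE; apply/qcls_eq.
apply: (qd_trans (qd_mulA _ _ _ _)); apply: qd_sym.
apply: (qd_trans (qd_mulA _ _ _ _)); apply: qd_congM; last exact: qd_refl.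
by apply: qd_sym; exact: qd_central.
Qed.
HB.instance Definition _ := GRing.Lalgebra_isAlgebra.Build C A qscaleAr.

Definition dz : A := qcls QZ.
Definition dzs : A := qcls QZs.

Lemma qcls_const c : qcls (QC c) = c%:A.
Proof.
rewrite /GRing.scale /= qE; apply/qcls_eq; apply: qd_sym; exact: qd_mul1r.
Qed.
Lemma qclsD s t : qcls (QAdd s t) = qcls s + qcls t.
Proof. by rewrite -qadd_cls. Qed.
Lemma qclsM s t : qcls (QMul s t) = qcls s * qcls t.
Proof. by rewrite -qmul_cls. Qed.

Lemma dzs_dz : dzs * dz = qC ^+ 2 *: (dz * dzs) + (1 - qC ^+ 2)%:A.
Proof.
rewrite /dz /dzs -(qclsM QZs) -(qclsM QZ) -[_ *: qcls _]mulr_algl -!qcls_const.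
rewrite -(qclsM (QC _)) -qclsD; apply/qcls_eq.
exact: qd_disc.
Qed.

Lemma qdisc_ind (P : A -> Prop) :
  P dz -> P dzs -> (forall c : C, P c%:A) ->
  (forall a b, P a -> P b -> P (a + b)) ->
  (forall a b, P a -> P b -> P (a * b)) -> forall a, P a.
Proof.
move=> Pz Pzs Pc PD PM; elim/qclsP; elim=> // [c|s Ps t Pt|s Ps t Pt].
- by rewrite qcls_const.
- by rewrite qclsD; exact: PD.
- by rewrite qclsM; exact: PM.
Qed.

(* The universal property of the presentation. *)
Section Lift.
Variables (B : algType C) (u v : B).
Hypothesis uv : v * u = qC ^+ 2 *: (u * v) + (1 - qC ^+ 2)%:A.

Definition qlift of v * u = qC ^+ 2 *: (u * v) + (1 - qC ^+ 2)%:A :=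
  fun a : A => qeval u v (qrep a).
Local Notation F := (qlift uv).

Lemma qlift_cls t : F (qcls t) = qeval u v t.
Proof. exact/(qeval_rel uv)/qrep_cls. Qed.

Fact qlift_zmod : zmod_morphism F.
Proof.
move=> a b; have FD x y : F (x + y) = F x + F y.
  by elim/qclsP: x => s; elim/qclsP: y => t; rewrite -qclsD !qlift_cls.
by apply/eqP; rewrite -subr_eq0 opprB addrA -FD subrK subrr.
Qed.
HB.instance Definition _ := GRing.isZmodMorphism.Build A B F qlift_zmod.
Fact qlift_monoid : monoid_morphism F.
Proof.
split; first by rewrite [1]/(qcls (QC 1)) qlift_cls /= scale1r.
by do 2!elim/qclsP=> ?; rewrite -qclsM !qlift_cls.
Qed.
HB.instance Definition _ := GRing.isMonoidMorphism.Build A B F qlift_monoid.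
Fact qlift_scalable : scalable F.
Proof.
move=> c; elim/qclsP=> t; rewrite -mulr_algl -qcls_const -qclsM !qlift_cls /=.
by rewrite mulr_algl.
Qed.
HB.instance Definition _ := GRing.isScalable.Build C A B *:%R F qlift_scalable.

Lemma qlift_z : F dz = u. Proof. exact: qlift_cls. Qed.
Lemma qlift_zs : F dzs = v. Proof. exact: qlift_cls. Qed.

Lemma qlift_uniq (G : {lrmorphism A -> B}) :
  G dz = u -> G dzs = v -> G =1 F.
Proof.
move=> Gz Gzs; elim/qdisc_ind=> [||c|a b Ga Gb|a b Ga Gb].
- by rewrite Gz qlift_z.
- by rewrite Gzs qlift_zs.
- by rewrite !linearZ !rmorph1.
- by rewrite !raddfD /= Ga Gb.
- by rewrite !rmorphM /= Ga Gb.
Qed.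
End Lift.

Fixpoint star_expr (t : qdisc_expr C) : qdisc_expr C :=
  match t with
  | QZ => QZs | QZs => QZ | QC c => QC (Num.conj c)
  | QAdd a b => QAdd (star_expr a) (star_expr b)
  | QMul a b => QMul (star_expr b) (star_expr a)
  end.

Definition star (a : A) : A := qcls (star_expr (qrep a)).

Lemma star_expr_rel s t :
  qdisc_rel qC s t -> qdisc_rel qC (star_expr s) (star_expr t).
Proof.
have qr : Num.conj qC = qC by rewrite conj_Creal // complex_real.
elim=> //=.
- by move=> a; exact: qd_refl.
- by move=> a b _; exact: qd_sym.
- by move=> a b c _ ab _ bc; exact: qd_trans bc.
- by move=> a a' b b' _ ? _ ?; exact: qd_congA.
- by move=> a a' b b' _ ? _ ?; exact: qd_congM.
- by move=> a b c; exact: qd_addA.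
- by move=> a b; exact: qd_addC.
- by move=> a; rewrite rmorph0; exact: qd_add0.
- move=> a; rewrite rmorphN1 rmorph0.
  apply: qd_trans (qd_addN _ (star_expr a)).
  by apply: qd_congA; [apply: qd_sym; exact: qd_central|exact: qd_refl].
- by move=> a b c; apply: qd_sym; exact: qd_mulA.
- by move=> a; rewrite rmorph1; exact: qd_mul1r.
- by move=> a; rewrite rmorph1; exact: qd_mul1l.
- by move=> a b c; exact: qd_mulDr.
- by move=> a b c; exact: qd_mulDl.
- by move=> c d; rewrite rmorphD; exact: qd_constD.
- by move=> c d; rewrite rmorphM mulrC; exact: qd_constM.
- by move=> c a; apply: qd_sym; exact: qd_central.
- rewrite !(rmorphB, rmorphXn, rmorph1) /= qr.
  apply: (qd_trans (qd_disc _)); apply: qd_congA; last exact: qd_refl.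
  exact: qd_central.
Qed.

Lemma star_cls t : star (qcls t) = qcls (star_expr t).
Proof. by apply/qcls_eq/star_expr_rel/qrep_cls. Qed.

Lemma star_z : star dz = dzs. Proof. exact: star_cls. Qed.
Lemma starD a b : star (a + b) = star a + star b.
Proof.
by elim/qclsP: a => s; elim/qclsP: b => t; rewrite -qclsD !star_cls -qclsD.
Qed.
Lemma starM a b : star (a * b) = star b * star a.
Proof.
by elim/qclsP: a => s; elim/qclsP: b => t; rewrite -qclsM !star_cls -qclsM.
Qed.
Lemma starZ c a : star (c *: a) = Num.conj c *: star a.
Proof.
elim/qclsP: a => t; rewrite -mulr_algl -qcls_const -qclsM !star_cls /=.
by rewrite qclsM qcls_const mulr_algr.
Qed.
Lemma starK : involutive star.
Proof.
elim/qclsP=> t; rewrite !star_cls; congr qcls.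
by elim: t => //= [c|s -> t ->|s -> t ->//]; rewrite ?conjCK.
Qed.

Lemma disc_relation :
  star dz * dz - qC ^+ 2 *: (dz * star dz) = (1 - qC ^+ 2)%:A.
Proof. by rewrite star_z dzs_dz addrC addKr. Qed.

Definition dx : A := 1 - dz * star dz.

(* z^l for integer l, with the convention z^l = z*^(-l) for l < 0. *)
Definition zpow (l : int) : A :=
  match l with Posz n => dz ^+ n | Negz n => star dz ^+ n.+1 end.

(* Grading: the degree n part is spanned by the words whose number of z's minus
   number of z*'s is n. *)
Inductive homogeneous : int -> A -> Prop :=
  | homog_z : homogeneous 1 dz
  | homog_zs : homogeneous (-1) (star dz)
  | homog_const (c : C) : homogeneous 0 c%:A
  | homog_0 n : homogeneous n 0
  | homogD n a b : homogeneous n a -> homogeneous n b -> homogeneous n (a + b)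
  | homogM m n a b :
      homogeneous m a -> homogeneous n b -> homogeneous (m + n) (a * b).

Fact sigma_relation :
  (qC ^- 2 *: dzs) * (qC ^+ 2 *: dz) =
  qC ^+ 2 *: ((qC ^+ 2 *: dz) * (qC ^- 2 *: dzs)) + (1 - qC ^+ 2)%:A.
Proof.
rewrite -!(scalerAl, scalerAr) !scalerA mulVf ?expf_neq0 ?qC_neq0 //.
rewrite mulfK ?expf_neq0 ?qC_neq0 // scale1r; exact: dzs_dz.
Qed.

(* The automorphism determined by z |-> q^2 z, z* |-> q^-2 z*; [sigma_homog]
   says that it is multiplication by q^(2 n) in degree n. *)
Definition sigma : A -> A := qlift sigma_relation.
HB.instance Definition _ := GRing.LRMorphism.on sigma.

Lemma sigma_z : sigma dz = qC ^+ 2 *: dz.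
Proof. exact: qlift_z. Qed.
Lemma sigma_zs : sigma dzs = qC ^- 2 *: dzs.
Proof. exact: qlift_zs. Qed.

Lemma sigma_homog n a : homogeneous n a -> sigma a = qC ^ (2 * n) *: a.
Proof.
elim=> {n a} [||c|n|n a b _ Ha _ Hb|m n a b _ Ha _ Hb].
- by rewrite sigma_z mulr1.
- by rewrite star_z sigma_zs mulrN1.
- by rewrite linearZ rmorph1 mulr0 expr0z scale1r.
- by rewrite linear0 scaler0.
- by rewrite raddfD /= Ha Hb scalerDr.
- rewrite rmorphM /= Ha Hb -scalerAl -scalerAr scalerA mulrDr.
  by rewrite expfzDr // qC_neq0.
Qed.

(* The linear map with D z = u, D z* = v and D (a b) = D a sigma(b) + a D b. *)
Section SkewDer.
Variables (u v : A).

Fixpoint skew_expr (t : qdisc_expr C) : A :=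
  match t with
  | QZ => u | QZs => v | QC _ => 0
  | QAdd a b => skew_expr a + skew_expr b
  | QMul a b => skew_expr a * sigma (qcls b) + qcls a * skew_expr b
  end.

Definition skew_compat : Prop :=
  v * sigma dz + dzs * u = qC ^+ 2 *: (u * sigma dzs + dz * v).

Definition skewder of skew_compat := fun a : A => skew_expr (qrep a).

Hypothesis uv : skew_compat.
Local Notation D := (skewder uv).

Lemma skew_expr_rel s t : qdisc_rel qC s t -> skew_expr s = skew_expr t.
Proof.
elim=> //=.
- by move=> b a c _ -> _ ->.
- by move=> a a' b b' _ -> _ ->.
- by move=> a a' b b' /qcls_eq -> -> /qcls_eq -> ->.
- by move=> a b c; rewrite addrA.
- by move=> a b; rewrite addrC.
- by move=> a; rewrite add0r.
- by move=> a; rewrite mul0r add0r qcls_const scaleN1r mulN1r addNr.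
- move=> a b c; rewrite !qclsM rmorphM mulrDl mulrDr !mulrA addrA.
  by rewrite -!addrA.
- by move=> a; rewrite mul0r add0r qcls_const scale1r mul1r.
- by move=> a; rewrite mulr0 addr0 qcls_const scale1r rmorph1 mulr1.
- by move=> a b c; rewrite qclsD !mulrDl addrACA.
- by move=> a b c; rewrite qclsD rmorphD !mulrDr addrACA.
- by move=> c d; rewrite addr0.
- by move=> c d; rewrite mul0r mulr0 addr0.
- move=> c a; rewrite mul0r add0r mulr0 addr0 qcls_const linearZ rmorph1.
  by rewrite mulr_algl mulr_algr.
- by rewrite mul0r add0r addr0 qcls_const mulr_algl.
Qed.

Lemma skewder_cls t : D (qcls t) = skew_expr t.
Proof. exact/skew_expr_rel/qrep_cls. Qed.

Lemma skewder_z : D dz = u. Proof. exact: skewder_cls. Qed.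
Lemma skewder_zs : D dzs = v. Proof. exact: skewder_cls. Qed.
Lemma skewderM a b : D (a * b) = D a * sigma b + a * D b.
Proof.
by elim/qclsP: a => s; elim/qclsP: b => t; rewrite -qclsM !skewder_cls.
Qed.
Fact skewder_linear : linear D.
Proof.
move=> c; elim/qclsP=> s; elim/qclsP=> t.
rewrite -mulr_algl -qcls_const -qclsM -qclsD !skewder_cls /=.
by rewrite mul0r add0r qcls_const mulr_algl.
Qed.
HB.instance Definition _ := GRing.isLinear.Build C A A *:%R D skewder_linear.

Lemma skewder_uniq (E : {linear A -> A}) : E dz = u -> E dzs = v ->
  (forall a b, E (a * b) = E a * sigma b + a * E b) -> E =1 D.
Proof.
move=> Ez Ezs EM.
have E1 : E 1 = 0.
  have := EM 1 1; rewrite !mul1r rmorph1 mulr1 => /eqP.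
  by rewrite -subr_eq0 opprD addrA subrr sub0r oppr_eq0 => /eqP.
have D1 : D 1 = 0 by rewrite [1]/(qcls (QC 1)) skewder_cls.
elim/qdisc_ind=> [||c|a b Ea Eb|a b Ea Eb].
- by rewrite Ez skewder_z.
- by rewrite Ezs skewder_zs.
- by rewrite !linearZ /= E1 D1.
- by rewrite !raddfD /= Ea Eb.
- by rewrite EM skewderM Ea Eb.
Qed.
End SkewDer.

Fact partial_compat : skew_compat dzs 0.
Proof.
rewrite /skew_compat sigma_zs mul0r add0r mulr0 addr0 -scalerAr scalerA.
by rewrite mulfV ?expf_neq0 ?qC_neq0 // scale1r.
Qed.
Fact partialbar_compat : skew_compat 0 (qC ^+ 2 *: dz).
Proof.
by rewrite /skew_compat sigma_z mulr0 addr0 mul0r add0r -!(scalerAl, scalerAr).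
Qed.

Definition partial : A -> A := skewder partial_compat.
HB.instance Definition _ := GRing.Linear.on partial.
Definition partialbar : A -> A := skewder partialbar_compat.
HB.instance Definition _ := GRing.Linear.on partialbar.

Lemma partial_z : partial dz = star dz.
Proof. by rewrite star_z; exact: skewder_z. Qed.
Lemma partial_zs : partial (star dz) = 0.
Proof. by rewrite star_z; exact: skewder_zs. Qed.
Lemma partialM a b : partial (a * b) = partial a * sigma b + a * partial b.
Proof. exact: skewderM. Qed.
Lemma partialbar_z : partialbar dz = 0.
Proof. exact: skewder_z. Qed.
Lemma partialbar_zs : partialbar (star dz) = qC ^+ 2 *: dz.
Proof. by rewrite star_z; exact: skewder_zs. Qed.
Lemma partialbarM a b :
  partialbar (a * b) = partialbar a * sigma b + a * partialbar b.
Proof. exact: skewderM. Qed.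

(* The free left module on omega, omega*: (a, b) stands for
   a omega + b omega*. *)
Definition Omega1 : Type := (A^o * A^o)%type.
HB.instance Definition _ := GRing.Lmodule.on Omega1.

Definition omega : Omega1 := (1, 0).
Definition omegabar : Omega1 := (0, 1).

Definition Omega1_act (w : Omega1) (a : A) : Omega1 := (w.1 * sigma a, w.2 * sigma a).

Definition dif (a : A) : Omega1 := (partial a, partialbar a).

Lemma Omega1E (w : Omega1) : w = (w.1 : A) *: omega + (w.2 : A) *: omegabar.
Proof.
case: w => a b; congr pair => /=.
  by rewrite /GRing.scale /= mulr1 mulr0 addr0.
by rewrite /GRing.scale /= mulr0 mulr1 add0r.
Qed.
Lemma omega_ract a : Omega1_act omega a = sigma a *: omega.
Proof. by congr pair => /=; rewrite /GRing.scale /= ?mul1r ?mulr1 ?mul0r ?mulr0. Qed.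
Lemma omegabar_ract a : Omega1_act omegabar a = sigma a *: omegabar.
Proof. by congr pair => /=; rewrite /GRing.scale /= ?mul1r ?mulr1 ?mul0r ?mulr0. Qed.
Lemma ract1 w : Omega1_act w 1 = w.
Proof. by case: w => a b; rewrite /Omega1_act rmorph1 /= !mulr1. Qed.
Lemma ractM w a b : Omega1_act w (a * b) = Omega1_act (Omega1_act w a) b.
Proof. by rewrite /Omega1_act rmorphM /= !mulrA. Qed.
Lemma ractDl w w' a : Omega1_act (w + w') a = Omega1_act w a + Omega1_act w' a.
Proof. by rewrite /Omega1_act /= !mulrDl. Qed.
Lemma ractDr w a b : Omega1_act w (a + b) = Omega1_act w a + Omega1_act w b.
Proof. by rewrite /Omega1_act rmorphD !mulrDr. Qed.
Lemma ractZl (a : A) w b : Omega1_act (a *: w) b = a *: Omega1_act w b.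
Proof. by congr pair; rewrite /= /GRing.scale /= mulrA. Qed.
Lemma dif_Leibniz a b : dif (a * b) = Omega1_act (dif a) b + a *: dif b.
Proof. by congr pair => /=; rewrite ?partialM ?partialbarM. Qed.

Definition right_linear : {pred Omega1 -> A} := fun f => `[<
  (forall w w', f (w + w') = f w + f w') /\
  (forall w a, f (Omega1_act w a) = f w * a) >].

Lemma right_linearP f : reflect
  ((forall w w', f (w + w') = f w + f w') /\
   (forall w a, f (Omega1_act w a) = f w * a)) (f \in right_linear).
Proof. exact: asboolP. Qed.

Fact right_linear_submod : submod_closed right_linear.
Proof.
split; first by apply/right_linearP; split=> * ; rewrite ?addr0 ?mul0r.
move=> c f g /right_linearP[fD fM] /right_linearP[gD gM].
apply/right_linearP; split=> [w w'|w a]; rewrite -![(_ + _ : _ -> _) _]/(c *: f _ + g _).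
  by rewrite fD gD scalerDr addrACA.
by rewrite fM gM mulrDl -scalerAl.
Qed.
HB.instance Definition _ := GRing.isSubmodClosed.Build C (Omega1 -> A)
  right_linear right_linear_submod.

Record rightHom := RightHom { rhom :> Omega1 -> A; _ : rhom \in right_linear }.
HB.instance Definition _ := [isSub for rhom].
HB.instance Definition _ := [Choice of rightHom by <:].
HB.instance Definition _ := [SubChoice_isSubLmodule of rightHom by <:].

Lemma rightHomD (f : rightHom) w w' : f (w + w') = f w + f w'.
Proof. by case: f => f /right_linearP[fD _] /=. Qed.
Lemma rightHom_ract (f : rightHom) w a : f (Omega1_act w a) = f w * a.
Proof. by case: f => f /right_linearP[_ fM] /=. Qed.

Definition nabla0 (f : rightHom) : A :=
  qC ^+ 4 *: partial (f omega) + qC ^- 4 *: partialbar (f omegabar).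

Fact nabla0_linear : linear nabla0.
Proof.
move=> c f g; rewrite /nabla0.
have E w : (c *: f + g : rightHom) w = c *: f w + g w by [].
have lp := skewder_linear partial_compat c.
have lpb := skewder_linear partialbar_compat c.
rewrite !E /partial /partialbar lp lpb !scalerDr !scalerA addrACA.
by rewrite -!(mulrC c) -!scalerA.
Qed.
HB.instance Definition _ := GRing.isLinear.Build C rightHom A *:%R nabla0
  nabla0_linear.

Definition nabla0_integral : A -> coker nabla0 := @to_coker C rightHom A nabla0.
HB.instance Definition _ := GRing.Linear.on nabla0_integral.

End QDisc.

(* Main.v *)
From HB Require Import structures.
Require Import Defs.
From mathcomp Require Import all_boot all_order all_algebra.
From mathcomp Require Import ring.
From mathcomp Require Import all_classical all_reals.
From mathcomp Require Import complex.
Set Implicit Arguments. Unset Strict Implicit. Unset Printing Implicit Defensive.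
Import Order.TTheory GRing.Theory Num.Theory.
Local Open Scope ring_scope.
Local Open Scope complex_scope.

(** Write s = q^2. The values of a right linear map on omega and omega* can be
    prescribed freely, so the image of the divergence is the sum of the images of
    the two skew-derivations ([nabla0_image]), and the claim is about linear maps
    on the disc algebra that vanish on these two images.

    The two derivations are two instances of one situation ([skew_data]): with
    (u, v, t) = (z, z*, s) or (z*, z, s^-1) and y = 1 - u v, the algebra satisfies
    v u = 1 - t y, and D u is a nonzero multiple of v while D v = 0. Writing
    [n] = [n; t^2], the Leibniz rule gives, up to nonzero factors,
      D(y^(k+1) v^m) = y^k v^(m+2),
      D(y^(k+1) u)   = [k+2] y^(k+1) v - [k+1] y^k v,
      D(y^(k+1) u^2) = (1+t) [k+2] y^(k+1) - t [k+1] y^k - [k+3] y^(k+2).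
    As t is not a root of unity, these relations, together with the values of D at
    u and at u^2, express every y^k v^m with m > 0 as an element of the image of D,
    and every y^k as a multiple of 1 modulo that image ([skew_killed]). Since the
    elements x^k z^l span the algebra ([monomial_ind]), the cokernel has dimension
    at most one ([linear0_divergence]).

    The last relation also determines the functional: the numbers
    a_k = [k+1] L(y^k) must satisfy a_(k+2) = (1+t) a_(k+1) - t a_k, a recursion
    solved by a_k = [k+1; t]; hence L(y^k) = [k+1; t] / [k+1; t^2]. It remains to
    see that there is such a functional L. That it is well defined on the presented
    algebra is the linear independence of the monomials; instead of a basis, one
    lets the algebra act from the right on all families g(k, l), thought of as the
    values of a functional at x^k z^l, and sets L(a) = (g a)(0, 0) for the required
    g ([dual_act], [Lambda_monomial]). That L vanishes on D(x^k z^l) follows from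
    the recursion when D(x^k z^l) has degree zero ([trace_skew_uu]), and from
    invariance of L under sigma in the other degrees ([trace_skew_homog]). So L
    induces an isomorphism of the cokernel with the scalars ([coker_Lambda_bij]),
    and every linear functional on the cokernel is its value at the class of 1
    times L. *)

(** * q-numbers *)

Section QNumbers.
Variables (F : fieldType) (t : F).

Lemma qnum0 : qnum 0 t = 0.
Proof. by rewrite /qnum expr0 subrr mul0r. Qed.

Lemma qnumS n : t != 1 -> qnum n.+1 t = t * qnum n t + 1.
Proof.
by rewrite -subr_eq0 => t1; rewrite /qnum exprS; field.
Qed.

(** The roots of the characteristic polynomial are 1 and t. *)
Lemma qnum_rec n : t != 1 ->
  (1 + t) * qnum n.+1 t - t * qnum n t - qnum n.+2 t = 0.
Proof. by move=> t1; rewrite !(qnumS _ t1); ring. Qed.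

Lemma qnum_neq0 n : (forall m, t ^+ m.+1 != 1) -> qnum n.+1 t != 0.
Proof.
by move=> t1; rewrite mulf_neq0 ?invr_eq0 // subr_eq0 ?t1 // -[t]expr1 t1.
Qed.

Lemma qnum_inv n : t != 0 -> t != 1 -> qnum n.+1 t^-1 = t ^- n * qnum n.+1 t.
Proof.
move=> t0; rewrite -subr_eq0 => t1.
by rewrite /qnum exprVn exprS; field;
  rewrite t1 expf_neq0 // t0 mulN1r -oppr_eq0 opprB.
Qed.

Lemma expz_neq1 (l : int) : (forall m, t ^+ m.+1 != 1) -> l != 0 -> t ^ l != 1.
Proof.
move=> t1; case: l => [[|n]|n] // _; first exact: t1.
by rewrite -[_ ^ _]/(t ^- n.+1) invr_eq1 t1.
Qed.
End QNumbers.


(** * A skew-derivation on a quantum disc *)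

(** What the two derivations of the quantum disc algebra have in common: t is a
    power of q, u and v are the generators in one of the two orders, and y is a
    scalar multiple of x = 1 - z z*. *)
Record skew_data (C : fieldType) (A : algType C) (sg : {lrmorphism A -> A})
    (D : {linear A -> A}) (u v y : A) (t c : C) : Prop := SkewData {
  skew_t0 : t != 0;
  skew_tn1 : forall n, t ^+ n.+1 != 1;
  skew_c0 : c != 0;
  skew_uv : u * v = 1 - y;
  skew_vu : v * u = 1 - t *: y;
  skew_sgu : sg u = t *: u;
  skew_sgv : sg v = t^-1 *: v;
  skew_Du : D u = c *: v;
  skew_Dv : D v = 0;
  skewM : forall a b : A, D (a * b) = D a * sg b + a * D b;
  skew_gen : forall P : A -> Prop, P u -> P v -> (forall b : C, P b%:A) ->
    (forall a b, P a -> P b -> P (a + b)) ->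
    (forall a b, P a -> P b -> P (a * b)) -> forall a, P a
}.

Section SkewDerivation.
Variables (C : fieldType) (A : algType C) (sg : {lrmorphism A -> A}).
Variables (D : {linear A -> A}) (u v y : A) (t c : C).
Hypothesis uvD : skew_data sg D u v y t c.
Local Notation br n := (qnum n (t ^+ 2)).

Let t0 := skew_t0 uvD.
Let tn1 := skew_tn1 uvD.
Let c0 := skew_c0 uvD.
Let uv := skew_uv uvD.
Let vu := skew_vu uvD.
Let sgu := skew_sgu uvD.
Let sgv := skew_sgv uvD.
Let Du := skew_Du uvD.
Let Dv := skew_Dv uvD.
Let DM := skewM uvD.

Let t2n1 n : (t ^+ 2) ^+ n.+1 != 1.
Proof. by rewrite -exprM mul2n doubleS tn1. Qed.
Let brS n : br n.+1 = t ^+ 2 * br n + 1.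
Proof. by rewrite qnumS // -[_ ^+ 2]expr1 t2n1. Qed.
Let br1 : br 1 = 1. Proof. by rewrite brS qnum0 mulr0 add0r. Qed.
Let br_neq0 n : br n.+1 != 0. Proof. exact: qnum_neq0. Qed.

Lemma skew_yE : y = 1 - u * v.
Proof. by rewrite uv opprB addrC subrK. Qed.

Lemma skew_vy : v * y = t *: (y * v).
Proof.
rewrite {1}skew_yE mulrBr mulr1 mulrA vu mulrBl mul1r opprB addrC subrK.
by rewrite -scalerAl.
Qed.

Lemma skew1 : D 1 = 0.
Proof.
have /eqP := DM 1 1; rewrite !mul1r rmorph1 mulr1 -subr_eq0.
by rewrite opprD addrA subrr sub0r oppr_eq0 => /eqP.
Qed.

Lemma skew_sgy : sg y = y.
Proof.
rewrite {1}skew_yE rmorphB rmorph1 rmorphM /= sgu sgv -scalerAl -scalerAr scalerA.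
by rewrite mulfV // scale1r -skew_yE.
Qed.

Lemma skew_y : D y = - (c / t) *: v ^+ 2.
Proof.
rewrite {1}skew_yE linearB /= skew1 sub0r DM Du Dv mulr0 addr0 sgv.
by rewrite -scalerAl -scalerAr scalerA scaleNr.
Qed.

Lemma skew_vvy : v ^+ 2 * y = t ^+ 2 *: (y * v ^+ 2).
Proof.
by rewrite !expr2 -mulrA skew_vy -scalerAr !mulrA skew_vy -scalerAl scalerA.
Qed.

(** The coefficient is the geometric sum coming from moving v^2 past the powers
    of y. *)
Lemma skew_yk k : D (y ^+ k.+1) = - (c / t * br k.+1) *: (y ^+ k * v ^+ 2).
Proof.
elim: k => [|k IHk]; first by rewrite expr1 skew_y br1 mulr1 expr0 mul1r.
rewrite exprSr DM skew_sgy IHk skew_y -scalerAl -(mulrA (y ^+ k)) skew_vvy.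
rewrite -!scalerAr !scalerA (mulrA (y ^+ k)) -exprSr -scalerDl (brS k.+1).
by congr (_ *: _); ring.
Qed.

Lemma skew_vm m : D (v ^+ m) = 0.
Proof.
elim: m => [|m IHm]; first exact: skew1.
by rewrite exprSr DM IHm Dv mulr0 mul0r addr0.
Qed.

Lemma skew_sgvm m : sg (v ^+ m) = t ^- m *: v ^+ m.
Proof. by rewrite rmorphXn /= sgv exprZn exprVn. Qed.

Lemma skew_yk_vm k m :
  D (y ^+ k.+1 * v ^+ m) =
  - (c / t ^+ m.+1 * br k.+1) *: (y ^+ k * v ^+ m.+2).
Proof.
rewrite DM skew_vm mulr0 addr0 skew_yk skew_sgvm -scalerAr -scalerAl scalerA.
rewrite -(mulrA (y ^+ k)) -exprD add2n; congr (_ *: _).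
by rewrite (exprS t m); field; rewrite t0 expf_neq0.
Qed.

Lemma skew_vvu : v ^+ 2 * u = v - t ^+ 2 *: (y * v).
Proof.
by rewrite expr2 -mulrA vu mulrBr mulr1 -scalerAr skew_vy scalerA.
Qed.

(** The Leibniz rule yields t^2 [k+1] + 1 = [k+2] as the coefficient of
    y^(k+1) v. *)
Lemma skew_yk_u k :
  D (y ^+ k.+1 * u) = c *: (br k.+2 *: (y ^+ k.+1 * v) - br k.+1 *: (y ^+ k * v)).
Proof.
rewrite DM skew_yk Du sgu -scalerAl -!scalerAr scalerA -(mulrA (y ^+ k)) skew_vvu.
rewrite mulrBr -scalerAr (mulrA (y ^+ k)) -exprSr !scalerBr !scalerA -!scaleNr.
rewrite -addrA -scalerDl.
by rewrite [RHS]addrC (brS k.+1); congr (_ *: _ + _ *: _); field.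
Qed.

Lemma skew_uu : D (u ^+ 2) = c *: ((1 + t)%:A - (1 + t ^+ 2) *: y).
Proof.
rewrite expr2 DM Du sgu -scalerAl -!scalerAr vu uv -scalerDr; congr (_ *: _).
rewrite scalerBr scalerA addrACA; congr (_ + _).
  by rewrite scalerDl scale1r addrC.
by rewrite -expr2 -opprD scalerDl scale1r addrC.
Qed.

Lemma skew_vvuu : v ^+ 2 * u ^+ 2 = 1 - (t + t ^+ 2) *: y + t ^+ 3 *: y ^+ 2.
Proof.
rewrite [u ^+ 2]expr2 mulrA skew_vvu mulrBl vu -scalerAl -(mulrA y) vu mulrBr mulr1.
rewrite -scalerAr -(expr2 y) scalerBr scalerA -exprSr opprB scalerDl opprD !addrA.
by rewrite addrAC.
Qed.

(** All three coefficients are q-numbers because t^2 [n] + 1 = [n+1]: the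
    coefficient of y^(k+1) is (1 + t) (t^2 [k+1] + 1), that of y^(k+2) is
    - (t^4 [k+1] + t^2 + 1). *)
Lemma skew_yk_uu k :
  D (y ^+ k.+1 * u ^+ 2) =
  c *: ((1 + t) * br k.+2 *: y ^+ k.+1 - t * br k.+1 *: y ^+ k
        - br k.+3 *: y ^+ k.+2).
Proof.
rewrite DM skew_yk skew_uu rmorphXn /= sgu exprZn -scalerAr -scalerAl.
rewrite -(mulrA (y ^+ k)) skew_vvuu.
rewrite !mulrDr !mulrN mulr1 -!scalerAr mulrDr mulrN -!scalerAr mulr1 -!exprSr.
rewrite -exprD addn2 !scalerDr !scalerN !scalerA -!scaleNr.
rewrite addrACA -[X in X + _ = _]addrA -!scalerDl [X in _ = X + _]addrC.
rewrite (brS k.+2) (brS k.+1).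
by congr (_ *: _ + _ *: _ + _ *: _); field.
Qed.

(** Modulo the image of D, the relations give y^k v^(m+2) = 0 directly, y^k v = 0
    by a first order recursion starting at D u = c v, and y^k as a multiple of 1 by
    a second order recursion starting at D(u^2). *)
Lemma skew_killed (W : lmodType C) (T : {linear A -> W}) :
  (forall a, T (D a) = 0) -> T 1 = 0 -> forall k m, T (y ^+ k * v ^+ m) = 0.
Proof.
move=> TD T1 k m.
have cancel (b : C) a : b != 0 -> T (b *: a) = 0 -> T a = 0.
  by move=> b0; rewrite linearZ_LR => /eqP; rewrite scaler_eq0 (negPf b0) => /eqP.
case: m => [|[|m]].
- have [] : T (y ^+ k) = 0 /\ T (y ^+ k.+1) = 0; last by rewrite expr0 mulr1.
  elim: k => [|k [IHk IHk1]]; split=> //.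
    have := TD (u ^+ 2); rewrite skew_uu => /cancel; move/(_ c0).
    rewrite linearB linearZ_LR /= T1 scaler0 sub0r -linearN -scaleNr expr1.
    apply: cancel; rewrite oppr_eq0; have := br_neq0 1.
    by rewrite brS br1 mulr1 addrC.
  have := TD (y ^+ k.+1 * u ^+ 2); rewrite skew_yk_uu => /cancel; move/(_ c0).
  rewrite !(linearB T) !(linearZ_LR T) /= IHk IHk1 !scaler0 subr0 sub0r.
  rewrite -scaleNr -linearZ_LR.
  by apply: cancel; rewrite oppr_eq0.
- rewrite expr1; elim: k => [|k IHk].
    by rewrite mul1r; have := TD u; rewrite Du; apply: cancel.
  have := TD (y ^+ k.+1 * u); rewrite skew_yk_u => /cancel; move/(_ c0).
  rewrite linearB !(linearZ_LR T) /= IHk scaler0 subr0 -linearZ_LR.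
  exact: cancel.
have := TD (y ^+ k.+1 * v ^+ m); rewrite skew_yk_vm; apply: cancel.
by rewrite oppr_eq0 mulf_neq0 ?br_neq0 // mulf_neq0 ?invr_eq0 ?expf_neq0.
Qed.

(** Multiplied by [k+1], the values of L at y^k become [k+1; t], and the formula
    for D(y^k u^2) turns into the recursion of these q-numbers. *)
Lemma trace_skew_uu (L : {linear A -> C^o}) :
  (forall k, L (y ^+ k) = qnum k.+1 t / br k.+1) ->
  forall k, L (D (y ^+ k * u ^+ 2)) = 0.
Proof.
move=> Ly k.
have LyE n : br n.+1 * L (y ^+ n) = qnum n.+1 t by rewrite Ly mulrC divfK.
have qS n : qnum n.+1 t = t * qnum n t + 1 by rewrite qnumS // -[t]expr1 tn1.
have br2 : 1 + t ^+ 2 = br 2 by rewrite brS br1 mulr1 addrC.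
case: k => [|k].
  rewrite mul1r skew_uu (linearZ_LR L) (linearB L) !(linearZ_LR L) /= br2.
  rewrite -[y]expr1 /GRing.scale /= LyE -(expr0 y) Ly br1 !qS qnum0.
  by rewrite divr1; ring.
rewrite skew_yk_uu (linearZ_LR L) !(linearB L) !(linearZ_LR L) /= /GRing.scale /=.
rewrite -(mulrA (1 + t)) -(mulrA t) (LyE k.+1) (LyE k) (LyE k.+2).
by rewrite qnum_rec ?mulr0 // -[t]expr1.
Qed.

(** The map u -> v lowers the degree by two, in the grading for which sigma
    multiplies degree n by t^n, and the Leibniz rule propagates this. *)
Lemma skew_sg a : sg (D a) = t ^- 2 *: D (sg a).
Proof.
elim/(skew_gen uvD): a => [||b|a b IHa IHb|a b IHa IHb].
- rewrite Du sgu (linearZ_LR sg) (linearZ_LR D) /= sgv Du !scalerA.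
  by congr (_ *: _); field.
- by rewrite sgv Dv (linearZ_LR D) /= Dv rmorph0 !scaler0.
- by rewrite (linearZ_LR sg) !(linearZ_LR D) /= rmorph1 skew1 !scaler0 rmorph0.
- by rewrite (linearD D) !rmorphD /= IHa IHb (linearD D) scalerDr.
- by rewrite DM rmorphD !rmorphM /= IHa IHb DM -scalerAl -scalerAr scalerDr.
Qed.

(** In degree l, invariance of L under sigma gives
    L(D a) = L(sigma(D a)) = t^(l-2) L(D a), and t is not a root of unity. *)
Lemma trace_skew_homog (L : {linear A -> C^o}) (l : int) a :
  (forall b, L (sg b) = L b) -> sg a = t ^ l *: a -> l != 2 -> L (D a) = 0.
Proof.
move=> Lsg sga l2; have := Lsg (D a).
rewrite skew_sg sga (linearZ_LR D) !(linearZ_LR L) /= scalerA => /eqP.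
rewrite -subr_eq0 -[X in _ - X]scale1r -scalerBl scaler_eq0 => /orP[|/eqP//].
rewrite subr_eq0 exprnN -expfzDr // addrC => t1.
by have := expz_neq1 tn1 (l := l - 2); rewrite subr_eq0 t1 => /(_ l2).
Qed.
End SkewDerivation.

(** * The two derivations of the quantum disc *)

Section Disc.
Variables (R : realType) (q : R) (q01 : 0 < q < 1).
Local Notation C := R[i].
Local Notation A := (qdisc q01).
Local Notation s := ((q%:C : C) ^+ 2).
Local Notation x := (dx q01).
Local Notation z := (dz q01).
Local Notation zs := (dzs q01).

Lemma s_neq0 : s != 0. Proof. by rewrite expf_neq0 ?(qC_neq0 q01). Qed.

Lemma s_pow_neq1 n : s ^+ n.+1 != 1.
Proof.
case/andP: q01 => q0 q1.
rewrite -exprM -(rmorphXn (real_complex R)) fmorph_eq1 lt_eqF //.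
by rewrite exprn_ilt1 // ltW.
Qed.

Lemma z_zs : z * zs = 1 - x.
Proof. by rewrite /dx star_z opprB addrC subrK. Qed.

Lemma zs_z : zs * z = 1 - s *: x.
Proof.
rewrite dzs_dz /dx star_z scalerBr opprB addrCA; congr (_ + _).
by rewrite scalerBl scale1r.
Qed.

Lemma partial_data :
  skew_data (@sigma R q q01) (@partial R q q01) z zs x s 1.
Proof.
split; first exact: s_neq0; first exact: s_pow_neq1; first exact: oner_neq0.
- exact: z_zs.
- exact: zs_z.
- exact: sigma_z.
- exact: sigma_zs.
- by rewrite scale1r -star_z; exact: partial_z.
- by rewrite -star_z; exact: partial_zs.
- exact: partialM.
exact: qdisc_ind.
Qed.

(** Exchanging the roles of z and z* replaces s by its inverse, and
    1 - z* z = s x takes the place of x = 1 - z z*. *)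
Lemma partialbar_data :
  skew_data (@sigma R q q01) (@partialbar R q q01) zs z (s *: x) s^-1 s.
Proof.
split; first by rewrite invr_eq0 s_neq0.
- by move=> n; rewrite exprVn invr_eq1 s_pow_neq1.
- exact: s_neq0.
- exact: zs_z.
- by rewrite scalerA mulVf ?s_neq0 // scale1r z_zs.
- exact: sigma_zs.
- by rewrite invrK; exact: sigma_z.
- by rewrite -star_z; exact: partialbar_zs.
- exact: partialbar_z.
- exact: partialbarM.
by move=> P Pzs Pz; exact: qdisc_ind.
Qed.

(** * The monomials span *)

Lemma zs_x : zs * x = s *: (x * zs).
Proof. exact: (skew_vy partial_data). Qed.

Lemma z_x : z * x = s^-1 *: (x * z).
Proof.
have := skew_vy partialbar_data.
rewrite -scalerAl -scalerAr => /(congr1 ( *:%R s^-1)).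
by rewrite !scalerA mulVf ?s_neq0 // mulrAC mulVf ?s_neq0 // mul1r scale1r.
Qed.

Lemma z_xk k : z * x ^+ k = s ^- k *: (x ^+ k * z).
Proof.
elim: k => [|k IHk]; first by rewrite invr1 scale1r mul1r mulr1.
rewrite (exprSr x) (mulrA z) IHk -scalerAl -(mulrA (x ^+ k) z x) z_x.
rewrite -scalerAr scalerA.
by rewrite (mulrA (x ^+ k)) -invfM -(exprSr s).
Qed.

Lemma zs_xk k : zs * x ^+ k = s ^+ k *: (x ^+ k * zs).
Proof.
elim: k => [|k IHk]; first by rewrite scale1r mul1r mulr1.
rewrite (exprSr x) (mulrA zs) IHk -scalerAl -(mulrA (x ^+ k) zs x) zs_x.
rewrite -scalerAr scalerA.
by rewrite (mulrA (x ^+ k)) (exprSr s).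
Qed.

Inductive mspan : A -> Prop :=
 | mspan_mono k l : mspan (x ^+ k * zpow q01 l)
 | mspan_lin c a b : mspan a -> mspan b -> mspan (c *: a + b).

Lemma mspan0 : mspan 0.
Proof.
have := mspan_lin (-1) (mspan_mono 0 0) (mspan_mono 0 0).
by rewrite scaleN1r addNr.
Qed.

Lemma mspanZ c a : mspan a -> mspan (c *: a).
Proof. by move=> /(mspan_lin c)/(_ mspan0); rewrite addr0. Qed.

Lemma mspanD a b : mspan a -> mspan b -> mspan (a + b).
Proof. by move=> sa /(mspan_lin 1 sa); rewrite scale1r. Qed.

Lemma mspan_mul_monomial (u : A) :
  (forall k l, mspan (u * (x ^+ k * zpow q01 l))) ->
  forall a, mspan a -> mspan (u * a).
Proof.
move=> uP a; elim=> // c b d _ sb _ sd.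
by rewrite mulrDr -scalerAr; apply: mspan_lin.
Qed.

Lemma mspan_z a : mspan a -> mspan (z * a).
Proof.
apply: mspan_mul_monomial => k l; rewrite mulrA z_xk -scalerAl; apply: mspanZ.
rewrite -mulrA; case: l => [n|n].
  by rewrite -exprS; apply: (mspan_mono _ n.+1%:Z).
rewrite /= star_z exprS (mulrA z) z_zs mulrBl mul1r mulrBr mulrA -exprSr.
rewrite addrC -scaleN1r; case: n => [|n].
  by apply: mspan_lin; exact: (mspan_mono _ 0).
by rewrite -star_z; apply: mspan_lin; exact: (mspan_mono _ (Negz n)).
Qed.

Lemma mspan_zs a : mspan a -> mspan (zs * a).
Proof.
apply: mspan_mul_monomial => k l; rewrite mulrA zs_xk -scalerAl; apply: mspanZ.
rewrite -mulrA; case: l => [[|n]|n].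
- by rewrite mulr1 -[zs]expr1 -star_z; apply: (mspan_mono _ (Negz 0)).
- rewrite /= exprS (mulrA zs) zs_z mulrBl mul1r mulrBr -scalerAl -scalerAr.
  rewrite mulrA -exprSr.
  by rewrite addrC -scaleNr; apply: mspan_lin; exact: (mspan_mono _ n%:Z).
by rewrite /= star_z -exprS -star_z; apply: (mspan_mono _ (Negz n.+1)).
Qed.

(** The span of the monomials contains 1 and is stable under left multiplication
    by the generators. *)
Lemma mspanP a : mspan a.
Proof.
suff: forall b, mspan b -> mspan (a * b).
  by move/(_ _ (mspan_mono 0 0)); rewrite !mulr1.
elim/qdisc_ind: a => [||c|a b IHa IHb|a b IHa IHb] d sd.
- exact: mspan_z.
- exact: mspan_zs.
- by rewrite mulr_algl; apply: mspanZ.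
- by rewrite mulrDl; apply: mspanD; [apply: IHa|apply: IHb].
- by rewrite -mulrA; apply/IHa/IHb.
Qed.

Lemma monomial_ind (P : A -> Prop) :
  (forall (c : C) a b, P a -> P b -> P (c *: a + b)) ->
  (forall k l, P (x ^+ k * zpow q01 l)) -> forall a, P a.
Proof. by move=> PZD Pmono a; elim: (mspanP a) => // *; apply: PZD. Qed.

Lemma linear0_monomial (W : lmodType C) (T : {linear A -> W}) :
  (forall k l, T (x ^+ k * zpow q01 l) = 0) -> forall a, T a = 0.
Proof.
move=> T0; apply: monomial_ind T0 => c a b Ta Tb.
by rewrite linearP Ta Tb scaler0 addr0.
Qed.

(** * The right action on functionals *)

Local Notation fnl := (nat -> int -> C).

(** If g(k, l) = phi(x^k z^l) for a functional phi, then the action of e gives the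
    values of the functional a |-> phi(e a). For the generators this means writing
    z x^k z^l and z* x^k z^l in terms of monomials: they are s^-k x^k z^(l+1) and
    s^k x^k z^(l-1) up to a correction, from z z* = 1 - x and z* z = 1 - s x, where
    the exponent of z moves towards 0. *)
Fixpoint expr_act (e : qdisc_expr C) (g : fnl) : fnl :=
  match e with
  | QZ => fun k l => s ^- k * (g k (l + 1) - (l < 0)%R%:R * g k.+1 (l + 1))
  | QZs => fun k l => s ^+ k * (g k (l - 1) - (0 < l)%R%:R * s * g k.+1 (l - 1))
  | QC c => fun k l => c * g k l
  | QAdd a b => fun k l => expr_act a g k l + expr_act b g k l
  | QMul a b => expr_act b (expr_act a g)
  end.

Lemma expr_act_ext e (g h : fnl) : g =2 h -> expr_act e g =2 expr_act e h.
Proof.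
by move=> gh; have -> : g = h by apply/funext => k; apply/funext => l; exact: gh.
Qed.

Lemma expr_act_linear e c (g h : fnl) k l :
  expr_act e (fun k l => c * g k l + h k l) k l =
  c * expr_act e g k l + expr_act e h k l.
Proof.
elim: e g h k l => [||d|a IHa b IHb|a IHa b IHb] g h k l /=.
- ring.
- ring.
- ring.
- rewrite IHa IHb; ring.
- by rewrite -IHb; apply: expr_act_ext => i j; rewrite IHa.
Qed.

Lemma expr_act0 e k l : expr_act e (fun _ _ => 0) k l = 0.
Proof.
rewrite -[RHS](addNr (expr_act e (fun _ _ => 0) k l)) -mulN1r -expr_act_linear.
by apply: expr_act_ext => i j; rewrite mulr0 addr0.
Qed.

Lemma expr_actZ e c (g : fnl) k l :
  expr_act e (fun k l => c * g k l) k l = c * expr_act e g k l.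
Proof.
have := expr_act_linear e c g (fun _ _ => 0) k l; rewrite expr_act0 addr0 => <-.
by apply: expr_act_ext => i j; rewrite addr0.
Qed.

Lemma expr_actD e (g h : fnl) k l :
  expr_act e (fun k l => g k l + h k l) k l = expr_act e g k l + expr_act e h k l.
Proof.
have := expr_act_linear e 1 g h k l; rewrite mul1r => <-.
by apply: expr_act_ext => i j; rewrite mul1r.
Qed.

(** The algebra axioms become linearity of the action; only the defining relation
    of the disc requires a computation, in which the sign of l decides which of the
    corrections occur. *)
Lemma expr_act_rel e f :
  qdisc_rel q%:C e f -> forall g, expr_act e g =2 expr_act f g.
Proof.
elim=> {e f} /=.
- by [].
- by move=> a b _ IH g k l; rewrite IH.
- by move=> b a c _ IH _ IH' g k l; rewrite IH IH'.
- by move=> a a' b b' _ IH _ IH' g k l; rewrite IH IH'.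
- move=> a a' b b' _ IH _ IH' g k l.
  by rewrite IH'; apply: expr_act_ext => i j; rewrite IH.
- by move=> a b c g k l; rewrite addrA.
- by move=> a b g k l; rewrite addrC.
- by move=> a g k l; rewrite mul0r add0r.
- by move=> a g k l; rewrite expr_actZ; ring.
- by [].
- by move=> a g; apply: expr_act_ext => k l; rewrite mul1r.
- by move=> a g k l; rewrite mul1r.
- by move=> a b c g k l; rewrite expr_actD.
- by move=> a b c g k l.
- by move=> c d g k l; rewrite mulrDl.
- by move=> c d g k l; ring.
- by move=> c a g k l; rewrite expr_actZ.
- move=> g k l; rewrite !addrK ?subrK.
  have s0 := s_neq0; have sk0 : s ^+ k != 0 by rewrite expf_neq0.
  rewrite !ltzD1 ltrBlDr ltzD1 !(exprS s k); move: (s ^+ k) sk0 => p p0.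
  by case: (ltrgtP l 0) => _ /=; field; rewrite p0 (qC_neq0 q01).
Qed.

Definition dual_act (a : A) (g : fnl) : fnl := expr_act (qrep a) g.

Lemma dual_act_cls e g : dual_act (qcls q01 e) g =2 expr_act e g.
Proof. exact/expr_act_rel/qrep_cls. Qed.

Lemma dual_actM a b g : dual_act (a * b) g = dual_act b (dual_act a g).
Proof.
apply/funext => k; apply/funext => l.
by rewrite -[a in LHS]qrepK -[b in LHS]qrepK -qclsM dual_act_cls.
Qed.

Lemma dual_act_linear c a b g k l :
  dual_act (c *: a + b) g k l = c * dual_act a g k l + dual_act b g k l.
Proof.
rewrite -[a in LHS]qrepK -[b in LHS]qrepK -mulr_algl -qcls_const -qclsM -qclsD.
by rewrite dual_act_cls /= expr_actZ.
Qed.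

Lemma dual_act1 g : dual_act 1 g = g.
Proof.
apply/funext => k; apply/funext => l.
by rewrite -[1]scale1r -qcls_const dual_act_cls /= mul1r.
Qed.

Lemma dual_act_x g k l : dual_act x g k l = g k.+1 l.
Proof.
rewrite /dx star_z addrC -scaleN1r dual_act_linear dual_act1 -qclsM.
rewrite dual_act_cls /= subrK.
have s0 := s_neq0; have sk0 : s ^+ k != 0 by rewrite expf_neq0.
rewrite !ltrBlDr ltzD1 !(exprS s k); move: (s ^+ k) sk0 => p p0.
by case: (ltrgtP l 0) => _ /=; field; rewrite p0 (qC_neq0 q01).
Qed.

Lemma dual_act_xk n g k l : dual_act (x ^+ n) g k l = g (n + k)%N l.
Proof.
elim: n k => [|n IHn] k; first by rewrite dual_act1.
by rewrite exprSr dual_actM dual_act_x IHn addnS.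
Qed.

(** Along z^l each step moves the exponent away from 0, so no correction occurs. *)
Lemma dual_act_zpow g l : dual_act (zpow q01 l) g 0 0 = g 0 l.
Proof.
have pos n m : dual_act (z ^+ n) g 0 m%:Z = g 0 (m + n)%N%:Z.
  elim: n m => [|n IHn] m; first by rewrite dual_act1 addn0.
  rewrite exprSr dual_actM dual_act_cls /= invr1 mul1r mul0r subr0 -PoszD.
  by rewrite IHn addn1 addSnnS.
have neg n m : dual_act (zs ^+ n) g 0 (- m%:Z) = g 0 (- (m + n)%N%:Z).
  elim: n m => [|n IHn] m; first by rewrite dual_act1 addn0.
  rewrite exprSr dual_actM dual_act_cls /= mul1r ltNge oppr_le0 /=.
  rewrite !mul0r subr0.
  by rewrite -opprD -PoszD IHn addn1 addSnnS.
case: l => n; first exact: (pos n 0).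
by rewrite /= star_z; have := neg n.+1 0; rewrite oppr0 NegzE.
Qed.

(** * The functional *)

Definition Lambda (a : A) : C^o :=
  dual_act a (fun k l => qnum k.+1 s / qnum k.+1 (s ^+ 2) * (l == 0)%:R) 0 0.

Fact Lambda_linear : linear Lambda.
Proof. by move=> c a b; exact: dual_act_linear. Qed.
HB.instance Definition _ := GRing.isLinear.Build C A C^o *:%R Lambda Lambda_linear.

Lemma Lambda_monomial k l :
  Lambda (x ^+ k * zpow q01 l) =
  qnum k.+1 s / qnum k.+1 (s ^+ 2) * (l == 0)%:R.
Proof. by rewrite /Lambda dual_actM dual_act_zpow dual_act_xk addn0. Qed.

Lemma Lambda_xk k : Lambda (x ^+ k) = qnum k.+1 s / qnum k.+1 (s ^+ 2).
Proof. by have := Lambda_monomial k 0; rewrite !mulr1. Qed.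

Lemma s_neq1 : s != 1. Proof. exact: (s_pow_neq1 0). Qed.

Lemma Lambda1 : Lambda 1 = 1.
Proof.
rewrite -(expr0 x) Lambda_xk !qnumS ?s_neq1 //; last first.
  by have := s_pow_neq1 1.
by rewrite !qnum0 !mulr0 !add0r divr1.
Qed.

Lemma sigma_x : sigma x = x.
Proof. exact: (skew_sgy partial_data). Qed.

Lemma sigma_monomial k l :
  sigma (x ^+ k * zpow q01 l) = s ^ l *: (x ^+ k * zpow q01 l).
Proof.
rewrite rmorphM rmorphXn /= sigma_x scalerAr; congr (_ * _).
case: l => n; rewrite /= rmorphXn /=; first by rewrite sigma_z exprZn.
by rewrite star_z sigma_zs exprZn exprVn.
Qed.

Lemma Lambda_sigma a : Lambda (sigma a) = Lambda a.
Proof.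
elim/monomial_ind: a => [c a b IHa IHb|k l].
  by rewrite !linearP /= IHa IHb.
rewrite sigma_monomial linearZ_LR /= Lambda_monomial; case: eqVneq => [->|_].
  by rewrite scale1r.
by rewrite mulr0 scaler0.
Qed.

Lemma Lambda_partial a : Lambda (partial a) = 0.
Proof.
move: a; apply: (linear0_monomial (T := Lambda \o @partial R q q01)) => k l /=.
have [->|l2] := eqVneq l 2.
  exact: (trace_skew_uu partial_data Lambda_xk).
exact: (trace_skew_homog partial_data Lambda_sigma (sigma_monomial k l) l2).
Qed.

(** The values required for the derivation with parameter s^-1 agree with those
    for s, because y = s x and [k+1; s^-1] = s^-k [k+1; s]. *)
Lemma Lambda_yk k : Lambda ((s *: x) ^+ k) = qnum k.+1 s^-1 / qnum k.+1 (s^-1 ^+ 2).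
Proof.
have s2 : s ^+ 2 != 1 by exact: (s_pow_neq1 1).
have p0 : s ^+ k != 0 by rewrite expf_neq0 ?s_neq0.
have Q0 : qnum k.+1 (s ^+ 2) != 0.
  by apply: qnum_neq0 => m; rewrite -(exprM s) mul2n doubleS s_pow_neq1.
rewrite exprZn linearZ_LR /= Lambda_xk exprVn.
rewrite !qnum_inv ?s_neq0 ?s_neq1 ?(expf_neq0 2 s_neq0) //.
rewrite (exprAC s 2 k) /GRing.scale /=.
move: (s ^+ k) (qnum _ s) (qnum _ _) p0 Q0 => p Q Q' p0 Q0.
by field; rewrite p0 Q0.
Qed.

Lemma Lambda_partialbar a : Lambda (partialbar a) = 0.
Proof.
have mono l k : l != -2 -> Lambda (partialbar (x ^+ k * zpow q01 l)) = 0.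
  move=> l2.
  have sgm : sigma (x ^+ k * zpow q01 l) = s^-1 ^ (- l) *: (x ^+ k * zpow q01 l).
    by rewrite sigma_monomial exprz_inv opprK.
  have l2' : - l != 2 by rewrite eqr_oppLR.
  exact: (trace_skew_homog partialbar_data Lambda_sigma sgm l2').
move: a; apply: (linear0_monomial (T := Lambda \o @partialbar R q q01)) => k l /=.
have [->|] := eqVneq l (-2); last exact: mono.
have := trace_skew_uu partialbar_data Lambda_yk k.
rewrite exprZn -scalerAl !linearZ_LR /= => /eqP.
by rewrite scaler_eq0 expf_eq0 (negPf s_neq0) andbF /= star_z => /eqP.
Qed.

(** * The cokernel *)

(** The derivation of degree 2 disposes of the x^k z^m, that of degree -2 of the
    x^k (z* )^m. *)
Lemma linear0_divergence (W : lmodType C) (T : {linear A -> W}) :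
  (forall a, T (partial a) = 0) -> (forall a, T (partialbar a) = 0) ->
  T 1 = 0 -> forall a, T a = 0.
Proof.
move=> Tp Tpb T1; apply: linear0_monomial => k [m|m].
  have := skew_killed partialbar_data Tpb T1 k m.
  rewrite exprZn -scalerAl linearZ_LR => /eqP.
  by rewrite scaler_eq0 expf_eq0 (negPf s_neq0) andbF /= => /eqP.
rewrite /= star_z.
exact: (skew_killed partial_data Tp T1).
Qed.

Fact sigmaV_relation :
  (s *: zs) * (s^-1 *: z) = s *: ((s^-1 *: z) * (s *: zs)) + (1 - s)%:A.
Proof.
rewrite -!(scalerAl, scalerAr) !scalerA !mulfV ?s_neq0 // mul1r scale1r.
exact: dzs_dz.
Qed.

Definition sigmaV : A -> A := qlift sigmaV_relation.
HB.instance Definition _ := GRing.LRMorphism.on sigmaV.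

Lemma sigmaV_z : sigmaV z = s^-1 *: z. Proof. exact: qlift_z. Qed.
Lemma sigmaV_zs : sigmaV zs = s *: zs. Proof. exact: qlift_zs. Qed.

Lemma sigmaVK : cancel (@sigma R q q01) sigmaV.
Proof.
elim/qdisc_ind=> [||c|a b IHa IHb|a b IHa IHb].
- by rewrite sigma_z linearZ_LR /= sigmaV_z scalerA mulfV ?s_neq0 // scale1r.
- by rewrite sigma_zs linearZ_LR /= sigmaV_zs scalerA mulVf ?s_neq0 // scale1r.
- by rewrite !linearZ_LR /= !rmorph1.
- by rewrite !rmorphD /= IHa IHb.
- by rewrite !rmorphM /= IHa IHb.
Qed.

(** The right module of 1-forms is free on omega and omega*, because
    a omega = omega sigma^-1(a); this is the right linear map with value a at omega
    and b at omega*. *)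
Fact rightHom_sub (a b : A) :
  (fun w : Omega1 q01 => a * sigmaV w.1 + b * sigmaV w.2) \in @right_linear R q q01.
Proof.
apply/right_linearP; split=> [w w'|w d] /=.
  by rewrite !rmorphD !mulrDr addrACA.
by rewrite !rmorphM /= sigmaVK mulrDl !mulrA.
Qed.

Lemma nabla0_image (a b : A) :
  exists f, nabla0 f = partial a + partialbar b :> A.
Proof.
exists (RightHom (rightHom_sub (q%:C ^- 4 *: a) (q%:C ^+ 4 *: b))).
have q4 : q%:C ^+ 4 != 0 :> C by rewrite expf_neq0 ?(qC_neq0 q01).
rewrite /nabla0 /= !rmorph1 !rmorph0 !mulr1 !mulr0 addr0 add0r.
rewrite (linearZ_LR (@partial R q q01)) (linearZ_LR (@partialbar R q q01)) /=.
by rewrite !scalerA mulfV // mulVf // !scale1r.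
Qed.

Lemma nabla0_integral_im (f : rightHom q01) : nabla0_integral (nabla0 f) = 0.
Proof.
rewrite -(raddf0 (@nabla0_integral R q q01)); apply/to_coker_eq.
by exists f; rewrite subr0.
Qed.

Lemma Lambda_nabla0 (f : rightHom q01) : Lambda (nabla0 f) = 0.
Proof.
rewrite /nabla0 linearD !(linearZ_LR (@Lambda)) /=.
by rewrite Lambda_partial Lambda_partialbar !scaler0 addr0.
Qed.

(** Both sides are linear in a, vanish on the image of the divergence and agree at
    a = 1. *)
Lemma nabla0_integralE a :
  nabla0_integral a = (Lambda a : C) *: nabla0_integral (1 : A).
Proof.
pose T (b : A) := nabla0_integral b - (Lambda b : C) *: nabla0_integral (1 : A).
have Tlin : linear T.
  move=> c b d; rewrite /T !linearP /= scalerDl scalerBr scalerA opprD.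
  by rewrite addrACA.
pose TM := GRing.isLinear.Build C A _ *:%R T Tlin.
pose TL : {linear A -> coker (@nabla0 R q q01)} := HB.pack T TM.
apply/eqP; rewrite -subr_eq0; apply/eqP.
apply: (linear0_divergence (T := TL)) => /= [b|b|].
- rewrite /T Lambda_partial scale0r subr0.
  have [f] := nabla0_image b 0; rewrite raddf0 addr0 => <-.
  exact: nabla0_integral_im.
- rewrite /T Lambda_partialbar scale0r subr0.
  have [f] := nabla0_image 0 b; rewrite raddf0 add0r => <-.
  exact: nabla0_integral_im.
by rewrite /T Lambda1 scale1r subrr.
Qed.

Definition coker_Lambda (c : coker (@nabla0 R q q01)) : C^o :=
  Lambda (repr (c : Quotient.quot (im_lin (@nabla0 R q q01)))).

Lemma coker_Lambda_integral a : coker_Lambda (nabla0_integral a) = Lambda a.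
Proof.
pose r : A := repr (nabla0_integral a : Quotient.quot (im_lin (@nabla0 R q q01))).
have [f] : exists f, nabla0 f = r - a.
  by apply/to_coker_eq; rewrite [LHS]reprK.
move/(congr1 Lambda); rewrite Lambda_nabla0 raddfB => /esym/eqP.
by rewrite subr_eq0 => /eqP.
Qed.

Fact coker_Lambda_linear : linear coker_Lambda.
Proof.
move=> c u v; have [a <-] := to_coker_surj u; have [b <-] := to_coker_surj v.
by rewrite -linearP !coker_Lambda_integral linearP.
Qed.
HB.instance Definition _ := GRing.isLinear.Build C _ C^o *:%R coker_Lambda
  coker_Lambda_linear.

Lemma coker_Lambda_bij : bijective coker_Lambda.
Proof.
exists (fun c : C => c *: nabla0_integral (1 : A)) => c.
  have [a <-] := to_coker_surj c.
  by rewrite coker_Lambda_integral -nabla0_integralE.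
by rewrite linearZ_LR /= coker_Lambda_integral Lambda1 /GRing.scale /= mulr1.
Qed.
End Disc.

Theorem theorem4p1 (R : realType) (q : R) (q01 : 0 < q < 1) :
  (exists phi : {linear coker (@nabla0 R q q01) -> (R[i])^o}, bijective phi) /\
  (forall phi : {linear coker (@nabla0 R q q01) -> (R[i])^o}, bijective phi ->
     exists lambda : R[i], forall (k : nat) (l : int),
       phi (@nabla0_integral R q q01 (dx q01 ^+ k * zpow q01 l)) =
       lambda * (qnum k.+1 (q%:C ^+ 2) / qnum k.+1 (q%:C ^+ 4)) * (l == 0)%:R).
Proof.
split; first by exists (coker_Lambda (q01 := q01)); exact: coker_Lambda_bij.
move=> phi _; exists (phi (@nabla0_integral R q q01 1)) => k l.
rewrite nabla0_integralE linearZ_LR /= Lambda_monomial -exprM.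
by rewrite /GRing.scale /= mulrC mulrA.
Qed.
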